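(* For every integer $n\geq 1$ and every complex number $m\in\mathbb{C}\setminus\mathbb{Z}^{-}$ with $m\neq -3/2$, \[ \sum_{k=1}^n \frac{2^{-2k}}{2k-1} \frac{\binom{2k}{k}}{\binom{m+k+1}{k}} H_{m+k+1} = \frac{4m+5}{(m+1)(2m+3)^2} + \frac{H_m}{2m+3} - \frac{2^{-2n}}{2m+3} \frac{\binom{2n}{n}}{\binom{m+n+1}{n}}\left (H_{m+n+1} + \frac{2}{2m+3} \right ). \]
   Context: $\mathbb{Z}^{-}$ denotes the set of negative integers. For complex $r,s$ the generalized binomial coefficient is $\binom{r}{s}=\frac{\Gamma(r+1)}{\Gamma(s+1)\Gamma(r-s+1)}$. For $z\in\mathbb{C}\setminus\mathbb{Z}^{-}$ the harmonic number is $H_z=\psi(z+1)+\gamma$, where $\psi=\Gamma'/\Gamma$ is the digamma function and $\gamma$ the Euler–Mascheroni constant; for a non-negative integer $n$ this gives $H_n=\sum_{k=1}^n 1/k$. *)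

(* Defs.v *)
From Stdlib Require Export Factorial Reals.
From Coquelicot Require Export Coquelicot.

Open Scope C_scope.

Definition Cexp (z : C) : C := exp (Re z) * (cos (Im z), sin (Im z)).

(** [C_lim_seq u] is the limit of [u] when [u] converges, and an unspecified
    value otherwise (as for [Lim_seq] and [C_lim]). *)
Definition C_lim_seq (u : nat -> C) : C :=
  (real (Lim_seq (fun n => Re (u n))), real (Lim_seq (fun n => Im (u n)))).

(** Rising factorial z (z + 1) ... (z + n - 1). *)
Fixpoint Cpoch (z : C) (n : nat) : C :=
  match n with
  | O => 1
  | S p => Cpoch z p * (z + INR p)
  end.

(** Euler's limit
      Gamma(z) = lim n! n^z / (z (z + 1) ... (z + n)),   n^z = exp (z ln n),
    valid at every z which is not a pole (0, -1, -2, ...).  At a pole the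
    terms are eventually 0 since [/ 0 = 0], so [Gamma] takes the value 0. *)
Definition Gamma (z : C) : C :=
  C_lim_seq (fun n => INR (fact n) * Cexp (z * ln (INR n)) / Cpoch z (S n)).

(** [C_derive] is total, and equals the complex derivative wherever Gamma is
    holomorphic. *)
Definition digamma (z : C) : C := C_derive Gamma z / Gamma z.

(** Euler-Mascheroni constant. *)
Definition euler_gamma : R :=
  real (Lim_seq (fun n => sum_n_m (fun k => / INR k)%R 1 n - ln (INR n))%R).

(** Harmonic number H_z; meaningful when z is not a negative integer. *)
Definition harmonic (z : C) : C := digamma (z + 1) + euler_gamma.

Definition Cbinom (r s : C) : C :=
  Gamma (r + 1) / (Gamma (s + 1) * Gamma (r - s + 1)).

(* Main.v *)
Require Import Defs.
From Stdlib Require Import Lra Lia.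

(** Every term is determined by the recurrences [Gamma (z + 1) = z Gamma z] and
    [H_(z + 1) = H_z + 1 / (z + 1)], after which the sum telescopes by a rational
    identity.  The first recurrence follows from Euler's limit once that limit
    is known to exist and to be nonzero; the second is its logarithmic derivative, for
    which the limit must be differentiable along horizontal lines.
    For [Re z > 2], [z = x + i y], Euler's terms are [exp (A_n + i B_n)] with
      A_n = ln n! + x ln n - 1/2 sum_(k <= n) ln ((x + k)^2 + y^2),
      B_n = y ln n - sum_(k <= n) atan (y / (x + k)).
    Their increments are O(1 / n^2), so both converge, and their second
    derivatives in [x] are bounded uniformly in [n], so the limits are
    differentiable.  The recurrence for Euler's terms then carries existence, nonvanishing
    and differentiability to the left, up to the poles. *)

(** * Real estimates *)

Open Scope R_scope.

(** Both sides come from [1 + x <= exp x]. The lower one is [ln (1 + t) >= 1 - / (1 + t) = t - t ^ 2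
    / (1 + t)], where [/ (1 + t) <= 2] on this range. *)
Lemma ln_1p_bound (t : R) : - (1 / 2) <= t -> Rabs (ln (1 + t) - t) <= 2 * t ^ 2.
Proof.
intros Ht.
assert (H1 : ln (1 + t) <= t).
{ rewrite <- (ln_exp t) at 2. apply ln_le; [lra | apply exp_ineq1_le]. }
assert (H2 : 1 - / (1 + t) <= ln (1 + t)).
{ assert (H : ln (/ (1 + t)) <= / (1 + t) - 1).
  { rewrite <- (ln_exp (/ (1 + t) - 1)).
    apply ln_le; [apply Rinv_0_lt_compat; lra |].
    generalize (exp_ineq1_le (/ (1 + t) - 1)); lra. }
  rewrite ln_Rinv in H; lra. }
assert (H3 : t - 2 * t ^ 2 <= 1 - / (1 + t)).
{ replace (1 - / (1 + t)) with (t - t ^ 2 * / (1 + t)) by (field; lra).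
  assert (/ (1 + t) <= 2).
  { replace 2 with (/ (1 / 2)) by field. apply Rinv_le_contravar; lra. }
  generalize (pow2_ge_0 t); nra. }
rewrite Rabs_left1; lra.
Qed.

(** Mean value inequality: the derivative of [atan s - s] is [- s ^ 2 / (1 + s ^ 2)], at most
    [Rabs s] in absolute value. A quadratic bound is enough for increments of order [1 / n ^ 2]. *)
Lemma atan_bound (p : R) : Rabs (atan p - p) <= p ^ 2.
Proof.
assert (H : Rabs ((fun s => atan s - s) p - (fun s => atan s - s) 0)
            <= Rabs p * Rabs (p - 0)).
{ apply (bounded_variation (fun s => atan s - s) (fun s => / (1 + s ^ 2) - 1)).
  intros s Hs; rewrite !Rminus_0_r in Hs.
  assert (Hq : 0 < / (1 + s ^ 2)) by (apply Rinv_0_lt_compat; nra).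
  split.
  - auto_derive; [trivial | unfold Rsqr; field; nra].
  - replace (/ (1 + s ^ 2) - 1) with (- (s ^ 2 / (1 + s ^ 2))) by (field; nra).
    rewrite Rabs_Ropp, Rabs_pos_eq by (apply Rmult_le_pos; nra).
    apply Rle_trans with (Rabs s); [| exact Hs].
    apply Rle_div_l; [nra |].
    rewrite <- (pow2_abs s).
    (* Completing the square: [1 + a ^ 2 - a = (a - 1 / 2) ^ 2 + 3 / 4] with [a = Rabs s]. *)
    replace (Rabs s * (1 + Rabs s ^ 2))
      with (Rabs s ^ 2 + Rabs s * ((Rabs s - 1 / 2) ^ 2 + 3 / 4)) by field.
    assert (0 <= Rabs s * ((Rabs s - 1 / 2) ^ 2 + 3 / 4)); [| lra].
    apply Rmult_le_pos; [apply Rabs_pos | nra]. }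
cbv beta in H. rewrite atan_0, !Rminus_0_r in H.
rewrite <- (pow2_abs p); simpl. rewrite Rmult_1_r. exact H.
Qed.

(** The mean value inequality is used twice: for [f'], then for [f t - t * f' x]. The interval is
    symmetric about [x] because [bounded_variation] asks for it. *)
Lemma taylor_bound (f f' f'' : R -> R) (M x y : R) :
  (forall t, Rabs (t - x) <= Rabs (y - x) ->
     is_derive f t (f' t) /\ is_derive f' t (f'' t) /\ Rabs (f'' t) <= M) ->
  Rabs (f y - f x - (y - x) * f' x) <= M * (y - x) ^ 2.
Proof.
intros H.
assert (HM : 0 <= M).
{ destruct (H x) as [_ [_ H0]].
  - rewrite Rminus_diag, Rabs_R0; apply Rabs_pos.
  - generalize (Rabs_pos (f'' x)); lra. }
assert (HR : Rabs ((fun t => f t - t * f' x) y - (fun t => f t - t * f' x) x)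
             <= M * Rabs (y - x) * Rabs (y - x)).
{ apply (bounded_variation (fun t => f t - t * f' x) (fun t => f' t - f' x)).
  intros t Ht; split.
  - apply (is_derive_minus f (fun t => t * f' x)); [apply H, Ht |].
    auto_derive; [trivial | ring].
  - apply Rle_trans with (M * Rabs (t - x)).
    + apply (bounded_variation f' f''). intros s Hs.
      destruct (H s) as [_ H0]; [lra | exact H0].
    + apply Rmult_le_compat_l; assumption. }
cbv beta in HR. rewrite <- (pow2_abs (y - x)).
replace (f y - f x - (y - x) * f' x) with (f y - y * f' x - (f x - x * f' x)) by ring.
simpl; lra.
Qed.

(** Cauchy criterion: [/ (n + 1) ^ 2 <= / n - / (n + 1)] makes the increments telescope. Indices
    start at 1, where [/ n] and [ln n] make sense. *)
Lemma ex_finite_lim_seq_sq_increments (u : nat -> R) (K : R) :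
  (forall n, (1 <= n)%nat -> Rabs (u (S n) - u n) <= K / INR (S n) ^ 2) ->
  ex_finite_lim_seq u.
Proof.
intros H.
assert (HK : 0 <= K).
{ generalize (H 1%nat (le_n _)) (Rabs_pos (u 2%nat - u 1%nat)); simpl; lra. }
assert (Hd : forall n p, (1 <= n)%nat ->
          Rabs (u (n + p)%nat - u n) <= K * (/ INR n - / INR (n + p))).
{ intros n p Hn; induction p as [|p IH].
  - rewrite Nat.add_0_r, !Rminus_diag, Rabs_R0; lra.
  - rewrite Nat.add_succ_r.
    assert (H1 : 1 <= INR (n + p)) by (apply (le_INR 1); lia).
    assert (H2 := H (n + p)%nat ltac:(lia)).
    assert (H3 : / INR (S (n + p)) ^ 2 <= / INR (n + p) - / INR (S (n + p))).
    { rewrite S_INR.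
      replace (/ INR (n + p) - / (INR (n + p) + 1))
        with (/ (INR (n + p) * (INR (n + p) + 1))) by (field; lra).
      apply Rinv_le_contravar; nra. }
    apply (Rmult_le_compat_l K) in H3; [| exact HK].
    replace (u (S (n + p)) - u n)
      with ((u (S (n + p)) - u (n + p)%nat) + (u (n + p)%nat - u n)) by ring.
    eapply Rle_trans; [apply Rabs_triang |]. unfold Rdiv in H2. lra. }
apply ex_lim_seq_cauchy_corr. intros eps.
assert (He := cond_pos eps).
(* This [N] gives [K / (N + 1) < eps / 2], so all later terms lie within [eps / 2] of [u (S N)]. *)
destruct (nfloor_ex (2 * K / eps)) as [N HN].
{ apply Rmult_le_pos; [lra | left; apply Rinv_0_lt_compat; lra]. }
exists (S N).
assert (Hb : forall n, (S N <= n)%nat -> Rabs (u n - u (S N)) < eps / 2).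
{ intros n Hn. replace n with (S N + (n - S N))%nat by lia.
  eapply Rle_lt_trans; [apply Hd; lia |].
  assert (0 < / INR (S N + (n - S N))) by (apply Rinv_0_lt_compat, lt_0_INR; lia).
  assert (0 < INR (S N)) by (apply lt_0_INR; lia).
  apply Rle_lt_trans with (K * / INR (S N)); [nra |].
  apply Rlt_div_l; [assumption |]. rewrite S_INR.
  destruct HN as [_ HN]. apply Rlt_div_l in HN; lra. }
intros n p Hn Hp.
replace (u n - u p) with ((u n - u (S N)) - (u p - u (S N))) by ring.
unfold Rminus at 1.
eapply Rle_lt_trans; [apply Rabs_triang |]. rewrite Rabs_Ropp.
generalize (Hb n Hn) (Hb p Hp); lra.
Qed.

(** The subtracted term carries the telescoping induction; the goal is the bound 2, uniform in
    [n]. *)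
Lemma sum_inv_sq_le (n : nat) :
  sum_f_R0 (fun k => / INR (S k) ^ 2) n <= 2 - / INR (S n).
Proof.
induction n as [|n IH].
- simpl; lra.
- rewrite tech5.
  assert (H1 : 1 <= INR (S n)) by (apply (le_INR 1); lia).
  rewrite (S_INR (S n)).
  assert (/ (INR (S n) + 1) ^ 2 <= / INR (S n) - / (INR (S n) + 1)).
  { replace (/ INR (S n) - / (INR (S n) + 1))
      with (/ (INR (S n) * (INR (S n) + 1))) by (field; lra).
    apply Rinv_le_contravar; nra. }
  lra.
Qed.

(* The slopes [d n] converge because any two of them differ by at most
   [2 M |h|] plus a difference quotient of [F n - F p]. *)
Lemma ex_derive_lim_quadratic (F : nat -> R -> R) (G : R -> R) (d : nat -> R)
    (x M r : R) :
  0 < r ->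
  (forall t, Rabs (t - x) < r -> is_lim_seq (fun n => F n t) (G t)) ->
  (forall n t, Rabs (t - x) < r ->
     Rabs (F n t - F n x - (t - x) * d n) <= M * (t - x) ^ 2) ->
  ex_derive G x.
Proof.
intros Hr HG HF.
assert (Hx : Rabs (x - x) < r) by (rewrite Rminus_diag, Rabs_R0; exact Hr).
assert (HM : 0 <= M).
{ assert (Ht : Rabs (x + r / 2 - x) < r).
  { replace (x + r / 2 - x) with (r / 2) by ring. rewrite Rabs_pos_eq; lra. }
  assert (H := Rle_trans _ _ _ (Rabs_pos _) (HF 0%nat _ Ht)).
  replace (x + r / 2 - x) with (r / 2) in H by ring.
  assert (0 < (r / 2) ^ 2) by (apply pow_lt; lra). nra. }
assert (Hd : ex_finite_lim_seq d).
{ apply ex_lim_seq_cauchy_corr. intros eps.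
  assert (He := cond_pos eps).
  (* After division by [h] the two quadratic remainders cost [2 * M * h <= eps / 4]; the tolerance
     [eps * h / 2] chosen below for the differences costs another [eps / 2]. *)
  set (h := Rmin (r / 2) (eps / (8 * (M + 1)))).
  assert (Hh : 0 < h).
  { apply Rmin_pos; [lra | apply Rdiv_lt_0_compat; lra]. }
  assert (Hh1 : h < r) by (generalize (Rmin_l (r / 2) (eps / (8 * (M + 1)))); fold h; lra).
  assert (Hh2 : h * (8 * (M + 1)) <= eps).
  { generalize (Rmin_r (r / 2) (eps / (8 * (M + 1)))); fold h.
    intros H; apply Rle_div_r in H; lra. }
  assert (Ht : Rabs (x + h - x) < r).
  { replace (x + h - x) with h by ring. rewrite Rabs_pos_eq; lra. }
  assert (Hex : ex_finite_lim_seq (fun n => F n (x + h) - F n x)).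
  { exists (G (x + h) - G x). apply (is_lim_seq_minus' (fun n => F n (x+h)) (fun n => F n x)); apply HG; assumption. }
  apply ex_lim_seq_cauchy_corr in Hex.
  assert (Heh : 0 < eps * h / 2) by nra.
  destruct (Hex (mkposreal _ Heh)) as [N HN]; simpl in HN.
  exists N; intros n p Hn Hp.
  assert (H1 := HF n _ Ht). assert (H2 := HF p _ Ht). assert (H3 := HN n p Hn Hp).
  replace (x + h - x) with h in H1, H2 by ring.
  apply Rabs_le_between in H1, H2. apply Rabs_lt_between in H3.
  apply Rabs_lt_between.
  split; apply Rmult_lt_reg_l with h; try assumption; nra. }
destruct Hd as [l Hl]. exists l.
(* The remainder bound is uniform in [n], so it survives the limit and makes [l] the derivative of
   [G]. *)
assert (Hlim : forall t, Rabs (t - x) < r ->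
          Rabs (G t - G x - (t - x) * l) <= M * (t - x) ^ 2).
{ intros t Ht.
  assert (H : is_lim_seq (fun n => Rabs (F n t - F n x - (t - x) * d n))
                         (Rabs (G t - G x - (t - x) * l))).
  { apply (is_lim_seq_abs _ (Finite _)).
    apply is_lim_seq_minus'; [apply is_lim_seq_minus'; auto |].
    apply (is_lim_seq_scal_l d (t - x) l), Hl. }
  apply (is_lim_seq_le _ (fun _ => M * (t - x) ^ 2) _ _ (fun n => HF n t Ht) H
           (is_lim_seq_const _)). }
apply is_derive_Reals. intros eps He.
assert (Hdl : 0 < Rmin r (eps / (M + 1))).
{ apply Rmin_pos; [exact Hr | apply Rdiv_lt_0_compat; lra]. }
exists (mkposreal _ Hdl). simpl. intros h Hh0 Hh.
assert (Hh1 : Rabs h < r) by (eapply Rlt_le_trans; [exact Hh | apply Rmin_l]).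
assert (Hh2 : Rabs h * (M + 1) < eps).
{ apply Rlt_div_r; [lra |]. eapply Rlt_le_trans; [exact Hh | apply Rmin_r]. }
assert (H := Hlim (x + h)). replace (x + h - x) with h in H by ring.
specialize (H Hh1).
assert (Hpos : 0 < Rabs h) by (apply Rabs_pos_lt, Hh0).
replace ((G (x + h) - G x) / h - l) with ((G (x + h) - G x - h * l) / h)
  by (field; exact Hh0).
unfold Rdiv; rewrite Rabs_mult, Rabs_inv.
apply Rlt_div_l; [exact Hpos |].
rewrite <- (pow2_abs h) in H. nra.
Qed.

(** * Modulus and argument of Euler's terms *)

(** Remainders add up, and since the weights [/ INR (S k) ^ 2] sum to less than 2 the constant is
    independent of [n], as [ex_derive_lim_quadratic] demands. *)
Lemma sum_quadratic_remainder (f : nat -> R -> R) (f' : nat -> R) (x t : R) (n : nat) :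
  (forall k, Rabs (f k t - f k x - (t - x) * f' k) <= / INR (S k) ^ 2 * (t - x) ^ 2) ->
  Rabs (sum_f_R0 (fun k => f k t) n - sum_f_R0 (fun k => f k x) n
        - (t - x) * sum_f_R0 f' n) <= 2 * (t - x) ^ 2.
Proof.
intros H.
apply Rle_trans with (sum_f_R0 (fun k => / INR (S k) ^ 2) n * (t - x) ^ 2).
- induction n as [|n IH]; [apply H |].
  rewrite !tech5.
  match goal with |- Rabs ?e <= _ => replace e with
    ((sum_f_R0 (fun k => f k t) n - sum_f_R0 (fun k => f k x) n - (t - x) * sum_f_R0 f' n)
     + (f (S n) t - f (S n) x - (t - x) * f' (S n))) by ring end.
  eapply Rle_trans; [apply Rabs_triang |].
  rewrite Rmult_plus_distr_r. apply Rplus_le_compat; [exact IH | apply H].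
- apply Rmult_le_compat_r; [apply pow2_ge_0 |].
  assert (0 < / INR (S n)) by (apply Rinv_0_lt_compat, lt_0_INR; lia).
  generalize (sum_inv_sq_le n); lra.
Qed.

Definition euler_logmod (y : R) (n : nat) (t : R) : R :=
  ln (INR (fact n)) + t * ln (INR n)
  - sum_f_R0 (fun k => / 2 * ln ((t + INR k) ^ 2 + y ^ 2)) n.

(** A continuous choice of argument, not reduced modulo [2 * PI]. For [t > 0] each [t + k] is
    positive, so [atan (y / (t + k))] is the argument of [t + k + i y]. *)
Definition euler_arg (y : R) (n : nat) (t : R) : R :=
  y * ln (INR n) - sum_f_R0 (fun k => atan (y / (t + INR k))) n.

Lemma ln_INR_succ (n : nat) : (1 <= n)%nat ->
  ln (INR n) = ln (INR (S n)) + ln (1 + - / INR (S n)).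
Proof.
intros Hn. assert (H : 1 <= INR n) by (apply (le_INR 1), Hn).
rewrite S_INR. rewrite <- ln_mult; [f_equal; field; lra | lra |].
replace (1 + - / (INR n + 1)) with (INR n * / (INR n + 1)) by (field; lra).
apply Rdiv_lt_0_compat; lra.
Qed.

Lemma inv_INR_succ_bounds (n : nat) : (1 <= n)%nat -> 0 < / INR (S n) <= / 2.
Proof.
intros Hn. assert (2 <= INR (S n)) by (apply (le_INR 2); lia).
split; [apply Rinv_0_lt_compat; lra | apply Rinv_le_contravar; lra].
Qed.

Lemma ex_lim_euler_logmod (y t : R) : 0 < t ->
  ex_finite_lim_seq (fun n => euler_logmod y n t).
Proof.
intros Ht.
(* The constant collects the bounds of the three terms into which the increment is split below. *)
apply (ex_finite_lim_seq_sq_increments _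
         (2 * t + (2 * t + t ^ 2 + y ^ 2) ^ 2 + / 2 * (t ^ 2 + y ^ 2))).
intros n Hn.
destruct (inv_INR_succ_bounds n Hn) as [He0 He1].
assert (HN : 0 < INR (S n)) by (apply lt_0_INR; lia).
unfold Rdiv at 1. rewrite <- pow_inv.
set (e := / INR (S n)) in *.
set (c := t ^ 2 + y ^ 2).
assert (Hc : 0 <= c) by (unfold c; nra).
set (s := 2 * t * e + c * e ^ 2).
assert (Hs0 : 0 <= s) by (unfold s; nra).
assert (Hs1 : s <= (2 * t + c) * e).
{ unfold s. assert (c * (e * e) <= c * (e * 1)); [| simpl; lra].
  do 2 (apply Rmult_le_compat_l; [lra |]); lra. }
assert (Hq : (t + INR (S n)) ^ 2 + y ^ 2 = INR (S n) ^ 2 * (1 + s)).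
{ unfold s, c, e; field; lra. }
(* With [e = / (n + 1)], the logarithms of [n + 1] cancel, and so do the first-order parts [t * e]
   and [s / 2 = t * e + c / 2 * e ^ 2], up to the last term. *)
replace (euler_logmod y (S n) t - euler_logmod y n t)
  with (- (t * (ln (1 + - e) - - e)) - / 2 * (ln (1 + s) - s) - c / 2 * e ^ 2).
2: { unfold euler_logmod. rewrite tech5, Hq, (ln_INR_succ n Hn). fold e.
  rewrite ln_mult, ln_pow by nra.
  replace (fact (S n)) with (S n * fact n)%nat by reflexivity.
  rewrite mult_INR, ln_mult by (try apply INR_fact_lt_0; lra).
  replace (INR 2) with 2 by (simpl; ring). unfold s; lra. }
assert (H1 := ln_1p_bound (- e) ltac:(lra)).
assert (H2 := ln_1p_bound s ltac:(lra)).
assert (H3 : s ^ 2 <= (2 * t + c) ^ 2 * e ^ 2).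
{ rewrite <- Rpow_mult_distr. apply pow_incr; lra. }
replace (2 * t + t ^ 2 + y ^ 2) with (2 * t + c) by (unfold c; ring).
fold c.
apply Rabs_le_between in H1, H2. apply Rabs_le_between.
assert (H4 : - (t * (2 * e ^ 2)) <= t * (ln (1 + - e) - - e) <= t * (2 * e ^ 2)) by nra.
assert (H5 : 0 <= e ^ 2) by apply pow2_ge_0.
assert (H6 : 0 <= c * e ^ 2) by (apply Rmult_le_pos; assumption).
split; lra.
Qed.

Lemma ex_lim_euler_arg (y t : R) : 0 < t ->
  ex_finite_lim_seq (fun n => euler_arg y n t).
Proof.
intros Ht.
apply (ex_finite_lim_seq_sq_increments _ (2 * Rabs y + Rabs y * t + y ^ 2)).
intros n Hn.
destruct (inv_INR_succ_bounds n Hn) as [He0 He1].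
assert (HN : 0 < INR (S n)) by (apply lt_0_INR; lia).
unfold Rdiv at 1. rewrite <- pow_inv.
set (e := / INR (S n)) in *.
set (q := / (t + INR (S n))).
assert (Hq0 : 0 < q) by (apply Rinv_0_lt_compat; lra).
assert (Hq1 : q <= e) by (apply Rinv_le_contravar; lra).
assert (Hqe : e - q = t * (e * q)) by (unfold e, q; field; lra).
(* The first-order parts [y * e] and [y * q] nearly cancel: [e - q = t * e * q] is already of second
   order. *)
replace (euler_arg y (S n) t - euler_arg y n t)
  with (- (y * (ln (1 + - e) - - e)) + y * (e - q) - (atan (y * q) - y * q)).
2: { unfold euler_arg. rewrite tech5, (ln_INR_succ n Hn).
  unfold Rdiv; fold e q; ring. }
assert (H1 := ln_1p_bound (- e) ltac:(lra)).
assert (H2 := atan_bound (y * q)).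
unfold Rminus at 1.
eapply Rle_trans; [apply Rabs_triang |]. rewrite Rabs_Ropp.
replace ((2 * Rabs y + Rabs y * t + y ^ 2) * e ^ 2)
  with ((Rabs y * (2 * e ^ 2) + Rabs y * (t * e ^ 2)) + y ^ 2 * e ^ 2) by ring.
apply Rplus_le_compat.
- eapply Rle_trans; [apply Rabs_triang |]. rewrite Rabs_Ropp, !Rabs_mult.
  apply Rplus_le_compat; apply Rmult_le_compat_l; try apply Rabs_pos.
  + lra.
  + rewrite Hqe, Rabs_pos_eq by nra. nra.
- eapply Rle_trans; [exact H2 |]. rewrite Rpow_mult_distr.
  apply Rmult_le_compat_l; [apply pow2_ge_0 | apply pow_incr; lra].
Qed.

(** The reason for [2 < x]: within distance 1 of [x] one has [s > 1], hence [s + k > k + 1]. This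
    bounds the second derivatives by a convergent series. *)
Lemma sqr_shift_le (x s y : R) (k : nat) : 2 < x -> Rabs (s - x) < 1 ->
  0 < s + INR k /\ / ((s + INR k) ^ 2 + y ^ 2) <= / INR (S k) ^ 2.
Proof.
intros Hx Hs. apply Rabs_lt_between in Hs. assert (Hk := pos_INR k).
split; [lra |]. rewrite S_INR.
apply Rinv_le_contravar; [apply pow_lt; lra |].
assert ((INR k + 1) ^ 2 <= (s + INR k) ^ 2) by (apply pow_incr; lra).
generalize (pow2_ge_0 y); lra.
Qed.

(** The part affine in [t] cancels, leaving the sum. With [u = t + k] its second derivatives are
    [(y ^ 2 - u ^ 2) / (u ^ 2 + y ^ 2) ^ 2], bounded by [/ (u ^ 2 + y ^ 2)]. *)
Lemma euler_logmod_quadratic (y x t : R) (n : nat) : 2 < x -> Rabs (t - x) < 1 ->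
  Rabs (euler_logmod y n t - euler_logmod y n x
        - (t - x) * (ln (INR n)
            - sum_f_R0 (fun k => (x + INR k) / ((x + INR k) ^ 2 + y ^ 2)) n))
  <= 2 * (t - x) ^ 2.
Proof.
intros Hx Ht.
rewrite <- Rabs_Ropp.
match goal with |- Rabs ?e <= _ => replace e with
  (sum_f_R0 (fun k => / 2 * ln ((t + INR k) ^ 2 + y ^ 2)) n
   - sum_f_R0 (fun k => / 2 * ln ((x + INR k) ^ 2 + y ^ 2)) n
   - (t - x) * sum_f_R0 (fun k => (x + INR k) / ((x + INR k) ^ 2 + y ^ 2)) n)
  by (unfold euler_logmod; ring) end.
apply (sum_quadratic_remainder (fun k t => / 2 * ln ((t + INR k) ^ 2 + y ^ 2))).
intros k.
apply (taylor_bound (fun t => / 2 * ln ((t + INR k) ^ 2 + y ^ 2))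
  (fun t => (t + INR k) / ((t + INR k) ^ 2 + y ^ 2))
  (fun t => (y ^ 2 - (t + INR k) ^ 2) / ((t + INR k) ^ 2 + y ^ 2) ^ 2)).
intros s Hs.
destruct (sqr_shift_le x s y k) as [Hu Hle]; [exact Hx | lra |].
set (u := s + INR k) in *.
assert (Hq : 0 < u ^ 2 + y ^ 2) by nra.
split; [| split].
- auto_derive; fold u; [lra | field; lra].
- auto_derive; fold u; [lra | field; lra].
- eapply Rle_trans; [| exact Hle].
  rewrite Rabs_div, (Rabs_pos_eq ((u ^ 2 + y ^ 2) ^ 2)) by nra.
  apply Rle_div_l; [nra |].
  replace (/ (u ^ 2 + y ^ 2) * (u ^ 2 + y ^ 2) ^ 2) with (u ^ 2 + y ^ 2) by (field; lra).
  apply Rabs_le_between; nra.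
Qed.

Lemma euler_arg_quadratic (y x t : R) (n : nat) : 2 < x -> Rabs (t - x) < 1 ->
  Rabs (euler_arg y n t - euler_arg y n x
        - (t - x) * sum_f_R0 (fun k => y / ((x + INR k) ^ 2 + y ^ 2)) n)
  <= 2 * (t - x) ^ 2.
Proof.
intros Hx Ht.
rewrite <- Rabs_Ropp.
match goal with |- Rabs ?e <= _ => replace e with
  (sum_f_R0 (fun k => atan (y / (t + INR k))) n
   - sum_f_R0 (fun k => atan (y / (x + INR k))) n
   - (t - x) * sum_f_R0 (fun k => - (y / ((x + INR k) ^ 2 + y ^ 2))) n) end.
2: { replace (sum_f_R0 (fun k => - (y / ((x + INR k) ^ 2 + y ^ 2))) n)
      with (- sum_f_R0 (fun k => y / ((x + INR k) ^ 2 + y ^ 2)) n).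
     - unfold euler_arg; ring.
     - clear; induction n as [|n IH]; [reflexivity |]. rewrite !tech5, <- IH; ring. }
apply (sum_quadratic_remainder (fun k t => atan (y / (t + INR k)))).
intros k.
apply (taylor_bound (fun t => atan (y / (t + INR k)))
  (fun t => - (y / ((t + INR k) ^ 2 + y ^ 2)))
  (fun t => 2 * (t + INR k) * y / ((t + INR k) ^ 2 + y ^ 2) ^ 2)).
intros s Hs.
destruct (sqr_shift_le x s y k) as [Hu Hle]; [exact Hx | lra |].
set (u := s + INR k) in *.
assert (Hq : 0 < u ^ 2 + y ^ 2) by nra.
split; [| split].
- auto_derive; fold u; [lra | unfold Rsqr; field; repeat split; nra].
- auto_derive; fold u; [lra | field; lra].
- eapply Rle_trans; [| exact Hle].
  rewrite Rabs_div, (Rabs_pos_eq ((u ^ 2 + y ^ 2) ^ 2)) by nra.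
  apply Rle_div_l; [nra |].
  replace (/ (u ^ 2 + y ^ 2) * (u ^ 2 + y ^ 2) ^ 2) with (u ^ 2 + y ^ 2) by (field; lra).
  (* The two squares give [2 * Rabs (u * y) <= u ^ 2 + y ^ 2]. *)
  apply Rabs_le_between; generalize (pow2_ge_0 (u - y)) (pow2_ge_0 (u + y)); nra.
Qed.

Lemma ex_derive_lim_euler_logmod (y x : R) : 2 < x ->
  ex_derive (fun t => real (Lim_seq (fun n => euler_logmod y n t))) x.
Proof.
intros Hx.
apply (ex_derive_lim_quadratic (euler_logmod y) _
  (fun n => ln (INR n) - sum_f_R0 (fun k => (x + INR k) / ((x + INR k) ^ 2 + y ^ 2)) n)
  x 2 1); [lra | |].
- intros t Ht. apply Lim_seq_correct', ex_lim_euler_logmod.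
  apply Rabs_lt_between in Ht; lra.
- intros n t Ht; apply euler_logmod_quadratic; assumption.
Qed.

Lemma ex_derive_lim_euler_arg (y x : R) : 2 < x ->
  ex_derive (fun t => real (Lim_seq (fun n => euler_arg y n t))) x.
Proof.
intros Hx.
apply (ex_derive_lim_quadratic (euler_arg y) _
  (fun n => sum_f_R0 (fun k => y / ((x + INR k) ^ 2 + y ^ 2)) n) x 2 1); [lra | |].
- intros t Ht. apply Lim_seq_correct', ex_lim_euler_arg.
  apply Rabs_lt_between in Ht; lra.
- intros n t Ht; apply euler_arg_quadratic; assumption.
Qed.

(** * The Gamma function off its poles *)

Open Scope C_scope.

(** * Complex exponential and polar form of Euler's terms *)

Lemma Cexp_plus (z w : C) : Cexp (z + w) = Cexp z * Cexp w.
Proof.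
destruct z as [a b], w as [c d].
unfold Cexp, Cmult, RtoC, Re, Im; simpl.
rewrite exp_plus, cos_plus, sin_plus.
apply injective_projections; simpl; ring.
Qed.

Lemma Cexp_0 : Cexp 0 = 1.
Proof.
unfold Cexp; simpl. rewrite exp_0, cos_0, sin_0.
apply injective_projections; simpl; ring.
Qed.

Lemma Cexp_neq_0 (z : C) : Cexp z <> 0.
Proof.
intros H. apply C1_nz. rewrite <- Cexp_0, <- (Cplus_opp_r z), Cexp_plus, H.
ring.
Qed.

Lemma Cexp_opp (z : C) : Cexp (- z) = / Cexp z.
Proof.
assert (H : Cexp z * Cexp (- z) = 1) by (rewrite <- Cexp_plus, Cplus_opp_r; apply Cexp_0).
rewrite <- (Cmult_1_r (/ Cexp z)), <- H. field; apply Cexp_neq_0.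
Qed.

Lemma Cexp_ln (r : R) : (0 < r)%R -> Cexp (ln r) = r.
Proof.
intros Hr. unfold Cexp; simpl. rewrite exp_ln, cos_0, sin_0 by exact Hr.
apply injective_projections; simpl; ring.
Qed.

(** The modulus is [t * sqrt (1 + (y / t)²)], and its root cancels the denominators of [cos_atan]
    and [sin_atan]. For [t > 0] the argument is [atan (y / t)]. *)
Lemma polar_form (t y : R) : (0 < t)%R ->
  (t, y) = Cexp ((/ 2 * ln (t ^ 2 + y ^ 2))%R, atan (y / t)).
Proof.
intros Ht. assert (Hq : (0 < t ^ 2 + y ^ 2)%R) by nra.
unfold Cexp, Re, Im; cbn [fst snd].
assert (Hs : exp (/ 2 * ln (t ^ 2 + y ^ 2)) = (t * sqrt (1 + (y / t)²))%R).
{ rewrite <- (sqrt_pow2 t) at 2 by lra. rewrite <- sqrt_mult; [| nra | unfold Rsqr; nra].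
  replace (t ^ 2 * (1 + (y / t)²))%R with (t ^ 2 + y ^ 2)%R by (unfold Rsqr; field; lra).
  rewrite <- Rpower_sqrt by exact Hq. reflexivity. }
assert (Hp : (0 < sqrt (1 + (y / t)²))%R) by (apply sqrt_lt_R0; unfold Rsqr; nra).
rewrite Hs, cos_atan, sin_atan.
apply injective_projections; simpl; field; lra.
Qed.

Definition euler_term (z : C) (n : nat) : C :=
  INR (fact n) * Cexp (z * ln (INR n)) / Cpoch z (S n).

Lemma Cpoch_polar (t y : R) (n : nat) : (0 < t)%R ->
  Cpoch (t, y) (S n)
  = Cexp (sum_f_R0 (fun k => / 2 * ln ((t + INR k) ^ 2 + y ^ 2))%R n,
          sum_f_R0 (fun k => atan (y / (t + INR k))) n).
Proof.
intros Ht.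
assert (Hf : forall k : nat, (t, y) + INR k
  = Cexp ((/ 2 * ln ((t + INR k) ^ 2 + y ^ 2))%R, atan (y / (t + INR k)))).
{ intros k. rewrite <- polar_form by (generalize (pos_INR k); lra).
  apply injective_projections; simpl; ring. }
induction n as [|n IH].
- cbn [Cpoch sum_f_R0]. rewrite <- (Hf 0%nat). ring.
- change (Cpoch (t, y) (S (S n))) with (Cpoch (t, y) (S n) * ((t, y) + INR (S n))).
  rewrite IH, Hf, <- Cexp_plus, !tech5. reflexivity.
Qed.

Lemma euler_term_polar (t y : R) (n : nat) : (0 < t)%R ->
  euler_term (t, y) n = Cexp (euler_logmod y n t, euler_arg y n t).
Proof.
intros Ht. unfold euler_term, Cdiv.
rewrite Cpoch_polar by exact Ht.
rewrite <- Cexp_opp, <- (Cexp_ln (INR (fact n))), <- !Cexp_plus by apply INR_fact_lt_0.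
f_equal. unfold euler_logmod, euler_arg.
apply injective_projections; simpl; ring.
Qed.

(** * Complex limits and the unit shift of Euler's terms *)

(** A relation, so that it asserts convergence, which the total function [C_lim_seq] cannot. *)
Definition is_C_lim_seq (u : nat -> C) (l : C) : Prop :=
  is_lim_seq (fun n => Re (u n)) (Re l) /\ is_lim_seq (fun n => Im (u n)) (Im l).

Lemma is_C_lim_seq_unique (u : nat -> C) (l : C) :
  is_C_lim_seq u l -> C_lim_seq u = l.
Proof.
intros [H1 H2]. unfold C_lim_seq.
rewrite (is_lim_seq_unique _ _ H1), (is_lim_seq_unique _ _ H2).
destruct l; reflexivity.
Qed.

Lemma is_C_lim_seq_mult (u v : nat -> C) (l k : C) :
  is_C_lim_seq u l -> is_C_lim_seq v k -> is_C_lim_seq (fun n => u n * v n) (l * k).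
Proof.
intros [H1 H2] [H3 H4]. split; simpl.
- apply is_lim_seq_minus'; apply is_lim_seq_mult'; assumption.
- apply is_lim_seq_plus'; apply is_lim_seq_mult'; assumption.
Qed.

Lemma is_C_lim_seq_ext_loc (u v : nat -> C) (l : C) :
  eventually (fun n => u n = v n) -> is_C_lim_seq u l -> is_C_lim_seq v l.
Proof.
intros [N HN] [H1 H2].
split; (eapply is_lim_seq_ext_loc; [| eassumption]);
  exists N; intros n Hn; rewrite (HN n Hn); reflexivity.
Qed.

(** Serves the ratio of Euler's terms at [z] and [z + 1], and the explicit terms at [z = 1]. *)
Lemma is_C_lim_seq_plus_div_INR (a b : C) :
  is_C_lim_seq (fun n => a + b * RtoC (/ INR n)) a.
Proof.
assert (Hi : is_lim_seq (fun n => / INR n)%R 0).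
{ apply (is_lim_seq_inv INR p_infty); [apply is_lim_seq_INR | discriminate]. }
assert (H : forall p q : R, is_lim_seq (fun n => p + q * / INR n)%R p).
{ intros p q. rewrite <- (Rplus_0_r p) at 1. rewrite <- (Rmult_0_r q).
  apply is_lim_seq_plus'; [apply is_lim_seq_const |].
  apply is_lim_seq_mult'; [apply is_lim_seq_const | exact Hi]. }
split.
- apply is_lim_seq_ext with (2 := H (Re a) (Re b)).
  intros n; unfold Re; simpl; ring.
- apply is_lim_seq_ext with (2 := H (Im a) (Im b)).
  intros n; unfold Im; simpl; ring.
Qed.

Lemma Cpoch_succ_l (z : C) (n : nat) : Cpoch z (S n) = z * Cpoch (z + 1) n.
Proof.
induction n as [|n IH]; [simpl; ring |].
change (Cpoch z (S (S n))) with (Cpoch z (S n) * (z + INR (S n))).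
rewrite IH, S_INR, RtoC_plus. simpl. ring.
Qed.

Lemma Cinv_0 : / (0 : C) = 0.
Proof. apply injective_projections; simpl; unfold Rdiv; ring. Qed.

(** The power gains a factor [n], and the products are [z (z + 1) ... (z + n)] and
    [(z + 1) ... (z + 1 + n)], so the ratio of the terms is [(z + 1 + n) / (z n)]. *)
Lemma euler_term_succ (z : C) (n : nat) :
  (1 <= n)%nat -> z <> 0 -> z + 1 + INR n <> 0 ->
  euler_term z n = euler_term (z + 1) n * (/ z + (z + 1) / z * RtoC (/ INR n)).
Proof.
intros Hn Hz Hzn.
assert (Hn0 : (0 < INR n)%R) by (apply lt_0_INR, Hn).
assert (HnC : RtoC (INR n) <> 0) by (intros H; apply RtoC_inj in H; lra).
unfold euler_term. rewrite Cpoch_succ_l.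
change (Cpoch (z + 1) (S n)) with (Cpoch (z + 1) n * (z + 1 + INR n)).
rewrite Cmult_plus_distr_r, Cexp_plus, Cmult_1_l, Cexp_ln, RtoC_inv by (exact Hn0 || lra).
(* If the common product vanishes, both terms are 0 because [/ 0 = 0], and the identity persists. *)
destruct (Ceq_dec (Cpoch (z + 1) n) 0) as [H0 | H0].
- rewrite H0, Cmult_0_l, Cmult_0_r. unfold Cdiv. rewrite Cinv_0. ring.
- field. repeat split; assumption.
Qed.

Lemma euler_term_lim_pred (z l : C) : z <> 0 ->
  is_C_lim_seq (euler_term (z + 1)) l -> is_C_lim_seq (euler_term z) (l / z).
Proof.
intros Hz Hl.
apply is_C_lim_seq_ext_loc with
  (fun n => euler_term (z + 1) n * (/ z + (z + 1) / z * RtoC (/ INR n))).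
(* Past this [N] the real part of [z + 1 + n] is positive, so the shift applies. *)
- destruct (nfloor_ex (Rabs (Re z)) (Rabs_pos _)) as [N [_ HN]].
  exists (S N). intros n Hn. symmetry. apply euler_term_succ; [lia | exact Hz |].
  intros H. apply (f_equal Re) in H. revert H. unfold Re in *; simpl.
  apply le_INR in Hn. rewrite S_INR in Hn.
  generalize (Rle_abs (- fst z)); rewrite Rabs_Ropp. lra.
- apply is_C_lim_seq_mult; [exact Hl | apply is_C_lim_seq_plus_div_INR].
Qed.

(** * Derivatives along horizontal lines *)

Definition is_hderive (f : C -> C) (z d : C) : Prop :=
  is_derive (fun t => Re (f (t, Im z))) (Re z) (Re d) /\
  is_derive (fun t => Im (f (t, Im z))) (Re z) (Im d).

Lemma Lim_diff_quotient (g h : R -> R) (x d : R) :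
  (forall t, t <> x -> h t = ((g t - g x) / (t - x))%R) ->
  is_derive g x d -> real (Lim h x) = d.
Proof.
intros Hh Hg. apply is_derive_Reals in Hg.
rewrite (is_lim_unique h x (Finite d)); [reflexivity |].
apply is_lim_spec. intros eps.
destruct (Hg eps (cond_pos eps)) as [del Hd].
exists del. intros t Ht Htx.
assert (Ht' : (Rabs (t - x) < del)%R) by exact Ht.
rewrite Hh by exact Htx.
replace (g t) with (g (x + (t - x))%R) by (f_equal; ring).
apply Hd; [lra | exact Ht'].
Qed.

(* [C_lim] only approaches along the horizontal line through [z], so
   [C_derive] is the derivative in the real direction. *)
Lemma C_derive_hderive (f : C -> C) (z d : C) : is_hderive f z d -> C_derive f z = d.
Proof.
intros [H1 H2]. unfold C_derive, C_lim. destruct z as [x y], d as [a b]; simpl in *.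
f_equal.
- apply (Lim_diff_quotient (fun t => Re (f (t, y)))); [| exact H1].
  intros t Ht. unfold Re; simpl. rewrite !Rplus_opp_r. field. intros H; apply Ht; lra.
- apply (Lim_diff_quotient (fun t => Im (f (t, y)))); [| exact H2].
  intros t Ht. unfold Im; simpl. rewrite !Rplus_opp_r. field. intros H; apply Ht; lra.
Qed.

(** * Convergence, nonvanishing and differentiability, from right to left *)

Lemma Gamma_lim (z l : C) : is_C_lim_seq (euler_term z) l -> Gamma z = l.
Proof. exact (is_C_lim_seq_unique _ l). Qed.

(** Convergence is required near [z] on its horizontal line, and not only at [z], so that the
    functional equation holds on a neighbourhood and can be differentiated. *)
Definition gamma_regular (z : C) : Prop :=
  locally (Re z) (fun t : R => exists l, is_C_lim_seq (euler_term (t, Im z)) l /\ l <> 0) /\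
  exists d, is_hderive Gamma z d.

Lemma gamma_regular_lim (z : C) : gamma_regular z ->
  is_C_lim_seq (euler_term z) (Gamma z) /\ Gamma z <> 0.
Proof.
intros [H _]. apply locally_singleton in H. destruct H as [l [Hl H0]].
rewrite <- surjective_pairing in Hl.
rewrite (Gamma_lim z l Hl). split; assumption.
Qed.

(** Continuity of [exp], [cos] and [sin] carries the limits of log-modulus and argument over; an
    exponential as limit is automatically nonzero. *)
Lemma is_C_lim_euler_term (t y : R) : (0 < t)%R ->
  is_C_lim_seq (euler_term (t, y))
    (Cexp (real (Lim_seq (fun n => euler_logmod y n t)),
           real (Lim_seq (fun n => euler_arg y n t)))).
Proof.
intros Ht.
assert (HA := Lim_seq_correct' _ (ex_lim_euler_logmod y t Ht)).
assert (HB := Lim_seq_correct' _ (ex_lim_euler_arg y t Ht)).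
apply is_C_lim_seq_ext_loc
  with (fun n => RtoC (exp (euler_logmod y n t))
                 * (cos (euler_arg y n t), sin (euler_arg y n t))).
{ exists 0%nat. intros n _. symmetry. apply euler_term_polar, Ht. }
apply is_C_lim_seq_mult; split; simpl.
- apply (is_lim_seq_continuous exp); [| exact HA].
  apply derivable_continuous_pt, derivable_pt_exp.
- apply is_lim_seq_const.
- apply (is_lim_seq_continuous cos); [apply continuity_cos | exact HB].
- apply (is_lim_seq_continuous sin); [apply continuity_sin | exact HB].
Qed.

Lemma gamma_regular_right (z : C) : (2 < Re z)%R -> gamma_regular z.
Proof.
destruct z as [x y]; unfold Re, Im; simpl; intros Hx.
assert (Hloc : locally x (fun t : R => (0 < t)%R)) by (apply (open_gt 0); lra).
destruct (ex_derive_lim_euler_logmod y x Hx) as [a Ha].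
destruct (ex_derive_lim_euler_arg y x Hx) as [b Hb].
split; simpl.
- apply filter_imp with (2 := Hloc). intros t Ht.
  eexists; split; [apply is_C_lim_euler_term, Ht | apply Cexp_neq_0].
- set (A := fun t => real (Lim_seq (fun n => euler_logmod y n t))) in *.
  set (B := fun t => real (Lim_seq (fun n => euler_arg y n t))) in *.
  assert (HG : forall t, (0 < t)%R -> Gamma (t, y) = Cexp (A t, B t))
    by (intros t Ht; apply Gamma_lim, is_C_lim_euler_term, Ht).
  change (is_derive A x a) in Ha. change (is_derive B x b) in Hb. clearbody A B.
  (* Real and imaginary parts of [(a + i b) exp (A + i B)]. *)
  exists ((exp (A x) * (a * cos (B x) - b * sin (B x)))%R,
          (exp (A x) * (a * sin (B x) + b * cos (B x)))%R).
  split; cbn [Re Im fst snd].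
  + apply is_derive_ext_loc with (fun t => exp (A t) * cos (B t))%R.
    { apply filter_imp with (2 := Hloc). intros t Ht.
      rewrite HG by exact Ht. simpl; ring. }
    auto_derive; [repeat apply conj; try exact I; eexists; eassumption |].
    rewrite (is_derive_unique (fun x : R => A x) _ _ Ha), (is_derive_unique (fun x : R => B x) _ _ Hb). ring.
  + apply is_derive_ext_loc with (fun t => exp (A t) * sin (B t))%R.
    { apply filter_imp with (2 := Hloc). intros t Ht.
      rewrite HG by exact Ht. simpl; ring. }
    auto_derive; [repeat apply conj; try exact I; eexists; eassumption |].
    rewrite (is_derive_unique (fun x : R => A x) _ _ Ha), (is_derive_unique (fun x : R => B x) _ _ Hb). ring.
Qed.

Lemma is_hderive_div_id (f g : C -> C) (z d : C) : z <> 0 ->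
  locally (Re z) (fun t : R => g (t, Im z) = f ((t, Im z) + 1) / (t, Im z)) ->
  is_hderive f (z + 1) d ->
  is_hderive g z (d / z - f (z + 1) / z ^ 2).
Proof.
destruct z as [x y], d as [a b]; unfold Re, Im; simpl.
intros Hz Hloc [H1 H2]. simpl in H1, H2.
rewrite Rplus_0_r in H1, H2.
assert (Hq : (0 < x ^ 2 + y ^ 2)%R).
{ destruct (Req_dec x 0) as [-> | Hx0]; [| nra].
  destruct (Req_dec y 0) as [-> | Hy0]; [| nra]. exfalso; apply Hz; reflexivity. }
set (u := fun t => Re (f (t, y))) in *. set (v := fun t => Im (f (t, y))) in *.
assert (Hg : locally x (fun t : R => g (t, y) = (u (t + 1)%R, v (t + 1)%R) / (t, y))).
{ apply filter_imp with (2 := Hloc). intros t ->. unfold u, v.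
  unfold Re, Im. rewrite <- surjective_pairing.
  do 2 f_equal. apply injective_projections; simpl; ring. }
assert (Hfz : f ((x, y) + 1) = (u (x + 1)%R, v (x + 1)%R)).
{ unfold u, v, Re, Im. rewrite <- surjective_pairing.
  f_equal. apply injective_projections; simpl; ring. }
rewrite Hfz. clear Hfz Hloc. clearbody u v.
split; simpl.
(* Division by [t + i y] is multiplication by the conjugate over the squared modulus; this is the
   real part. *)
- apply is_derive_ext_loc with (fun t => (t * u (t + 1) + y * v (t + 1)) / (t ^ 2 + y ^ 2))%R.
  { apply filter_imp with (2 := Hg). intros t ->. unfold Re; simpl. unfold Rdiv; ring. }
  auto_derive.
  { repeat apply conj; try exact I; try (eexists; eassumption). intros H; simpl in Hq; lra. }
  rewrite (is_derive_unique (fun x : R => u x) _ _ H1), (is_derive_unique (fun x : R => v x) _ _ H2).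
  field. nra.
- apply is_derive_ext_loc with (fun t => (t * v (t + 1) - y * u (t + 1)) / (t ^ 2 + y ^ 2))%R.
  { apply filter_imp with (2 := Hg). intros t ->. unfold Im; simpl. unfold Rdiv; ring. }
  auto_derive.
  { repeat apply conj; try exact I; try (eexists; eassumption). intros H; simpl in Hq; lra. }
  rewrite (is_derive_unique (fun x : R => u x) _ _ H1), (is_derive_unique (fun x : R => v x) _ _ H2).
  field. nra.
Qed.

Lemma locally_horizontal_neq_0 (z : C) : z <> 0 -> locally (Re z) (fun t : R => (t, Im z) <> RtoC 0).
Proof.
destruct z as [x y]; simpl; intros Hz.
destruct (Req_dec y 0) as [-> | Hy].
- assert (Hx : x <> 0) by (intros ->; apply Hz; reflexivity).
  apply filter_imp with (2 := open_neq 0 x Hx).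
  intros t Ht H; injection H; exact Ht.
- apply filter_forall. intros t H; injection H; intros; contradiction.
Qed.

(** One unit step to the left: the limit of Euler's terms is divided by [z], and the logarithmic
    derivative of [Gamma (z + 1) / z] is [digamma (z + 1) - / z]. *)
Lemma gamma_regular_pred (z : C) : z <> 0 -> gamma_regular (z + 1) ->
  gamma_regular z /\ Gamma z = Gamma (z + 1) / z /\ digamma z = digamma (z + 1) - / z.
Proof.
intros Hz Hr.
destruct (gamma_regular_lim _ Hr) as [Hl H0].
assert (HG : Gamma z = Gamma (z + 1) / z) by (apply Gamma_lim, euler_term_lim_pred; assumption).
destruct Hr as [Hloc [d Hd]].
assert (Hloc' : locally (Re z) (fun t : R => (t, Im z) <> RtoC 0 /\
          exists l, is_C_lim_seq (euler_term ((t, Im z) + 1)) l /\ l <> 0)).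
{ apply filter_and; [apply locally_horizontal_neq_0, Hz |].
  destruct Hloc as [eps He]. exists eps. intros t Ht.
  destruct (He (t + 1)%R) as [l Hl'].
  - simpl. replace (Re z + 1)%R with (plus (Re z) 1%R) by reflexivity.
    unfold ball in *; simpl in *; unfold AbsRing_ball, abs, minus, plus, opp in *; simpl in *.
    replace (t + 1 + - (fst z + 1))%R with (t + - fst z)%R by ring. exact Ht.
  - exists l. replace ((t, Im z) + 1) with ((t + 1)%R, Im (z + 1)); [exact Hl' |].
    apply injective_projections; simpl; unfold Im; ring. }
assert (Hd' : is_hderive Gamma z (d / z - Gamma (z + 1) / z ^ 2)).
{ apply is_hderive_div_id; [exact Hz | | exact Hd].
  apply filter_imp with (2 := Hloc'). intros t [Ht [l [Hlt _]]].
  rewrite (Gamma_lim _ _ Hlt).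
  apply Gamma_lim, euler_term_lim_pred; assumption. }
split; [split | split].
- apply filter_imp with (2 := Hloc'). intros t [Ht [l [Hlt Hl0]]].
  exists (l / (t, Im z)). split; [apply euler_term_lim_pred; assumption |].
  apply Cmult_neq_0; [exact Hl0 |].
  intros H. apply C1_nz. rewrite <- (Cinv_r _ Ht), H. ring.
- eexists; exact Hd'.
- exact HG.
- unfold digamma.
  rewrite (C_derive_hderive _ _ _ Hd'), (C_derive_hderive _ _ _ Hd), HG.
  field. split; assumption.
Qed.

Lemma gamma_regular_nonpole (z : C) : (forall j : nat, z <> - INR j) -> gamma_regular z.
(* Induction on the number of unit steps that bring [z] into [Re z > 2]. Since
   [Rabs (Re z) < N + 1], [N + 3] steps suffice. *)
Proof.
destruct (nfloor_ex (Rabs (Re z)) (Rabs_pos _)) as [N [_ HN]].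
assert (HzN : (2 < Re z + INR (N + 3))%R).
{ rewrite plus_INR; simpl INR.
  generalize (Rle_abs (- Re z)); rewrite Rabs_Ropp; lra. }
clear HN. revert z HzN. generalize (N + 3)%nat. clear N.
intros N; induction N as [|N IH]; intros z HzN Hz.
- apply gamma_regular_right. simpl in HzN; lra.
- apply gamma_regular_pred.
  + intros H. apply (Hz 0%nat). rewrite H. simpl. ring.
  + apply IH.
    * rewrite S_INR in HzN. unfold Re in *; simpl; lra.
    * intros j Hj. apply (Hz (S j)). rewrite S_INR, RtoC_plus.
      replace z with (z + 1 - 1) by ring. rewrite Hj. ring.
Qed.

Lemma Gamma_succ (z : C) : (forall j : nat, z <> - INR j) ->
  Gamma (z + 1) = z * Gamma z /\ digamma (z + 1) = digamma z + / z.
Proof.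
intros Hz.
assert (Hz0 : z <> 0) by (intros H; apply (Hz 0%nat); rewrite H; simpl; ring).
destruct (gamma_regular_pred z Hz0) as [_ [H1 H2]].
- apply gamma_regular_nonpole. intros j Hj. apply (Hz (S j)).
  rewrite S_INR, RtoC_plus. replace z with (z + 1 - 1) by ring. rewrite Hj. ring.
- split; [rewrite H1; field; exact Hz0 | rewrite H2; ring].
Qed.

Lemma Gamma_neq_0 (z : C) : (forall j : nat, z <> - INR j) -> Gamma z <> 0.
Proof. intros Hz; apply gamma_regular_lim, gamma_regular_nonpole, Hz. Qed.

(** At 1 the product is [(n + 1)!], so Euler's term is [n / (n + 1) = 1 - / (n + 1)]. *)
Lemma Gamma_1 : Gamma 1 = 1.
Proof.
apply Gamma_lim.
apply is_C_lim_seq_ext_loc with (fun n => 1 + - (1) * RtoC (/ INR (n + 1))).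
- exists 1%nat. intros n Hn.
  assert (Hn0 : (0 < INR n)%R) by (apply lt_0_INR, Hn).
  assert (Hp : forall k, Cpoch 1 k = INR (fact k)).
  { induction k as [|k IH]; [reflexivity |].
    simpl Cpoch. rewrite IH. rewrite fact_simpl, mult_INR, S_INR, RtoC_mult, RtoC_plus. ring. }
  unfold euler_term. rewrite Hp, Cmult_1_l, Cexp_ln by exact Hn0.
  rewrite Nat.add_1_r, fact_simpl, mult_INR, S_INR, RtoC_mult.
  assert (Hf := INR_fact_neq_0 n).
  rewrite RtoC_inv, RtoC_plus by lra.
  field. split.
  + intros H; apply RtoC_inj in H; contradiction.
  + rewrite <- RtoC_plus. intros H; apply RtoC_inj in H; lra.
- destruct (is_C_lim_seq_plus_div_INR 1 (- (1))) as [H1 H2].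
  split; [apply (is_lim_seq_incr_n _ 1) in H1; exact H1
         | apply (is_lim_seq_incr_n _ 1) in H2; exact H2].
Qed.

(** * Binomial coefficients and harmonic numbers *)

Lemma RtoC_INR_neq_opp (n j : nat) : RtoC (INR n) + 1 <> - INR j.
Proof.
intros H. apply (f_equal Re) in H. revert H. unfold Re; simpl.
generalize (pos_INR n) (pos_INR j); lra.
Qed.

Lemma RtoC_INR_plus_1_neq_0 (n : nat) : RtoC (INR n) + 1 <> 0.
Proof. intros H; apply (RtoC_INR_neq_opp n 0). rewrite H; simpl; ring. Qed.

Lemma nonpole_plus_INR (z : C) : (forall j : nat, z <> - INR j) ->
  forall n j : nat, z + INR n <> - INR j.
Proof.
intros Hz n j H. apply (Hz (n + j)%nat). rewrite plus_INR, RtoC_plus.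
replace z with (z + INR n - INR n) by ring. rewrite H; ring.
Qed.

Lemma Cbinom_0_r (r : C) : (forall j : nat, r + 1 <> - INR j) -> Cbinom r 0 = 1.
Proof.
intros Hr. unfold Cbinom.
replace (r - 0 + 1) with (r + 1) by ring.
replace (0 + 1) with (RtoC 1) by ring. rewrite Gamma_1.
field. apply Gamma_neq_0, Hr.
Qed.

(** The numerator [Gamma (2 k + 1)] moves up twice and each [Gamma (k + 1)] once: the ratio is
    [(2 k + 2) (2 k + 1) / (k + 1) ^ 2]. *)
Lemma Cbinom_double_succ (k : nat) :
  Cbinom (2 * INR (S k)) (INR (S k))
  = Cbinom (2 * INR k) (INR k) * (2 * (2 * INR k + 1) / (INR k + 1)).
Proof.
assert (Hp : forall n : nat, Gamma (RtoC (INR n) + 1 + 1) = (INR n + 1) * Gamma (INR n + 1))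
  by (intros n; apply Gamma_succ; intros j; apply RtoC_INR_neq_opp).
assert (Hk := RtoC_INR_plus_1_neq_0 k).
assert (HG : Gamma (INR k + 1) <> 0) by (apply Gamma_neq_0, RtoC_INR_neq_opp).
assert (H2 : 2 * RtoC (INR k) = INR (2 * k)) by (rewrite mult_INR, RtoC_mult; reflexivity).
unfold Cbinom. rewrite S_INR, RtoC_plus.
replace (2 * (INR k + 1) - (INR k + 1) + 1) with (RtoC (INR k) + 1 + 1) by ring.
replace (2 * INR k - INR k + 1) with (RtoC (INR k) + 1) by ring.
replace (2 * (INR k + 1) + 1) with (RtoC (INR (S (2 * k))) + 1 + 1)
  by (rewrite S_INR, RtoC_plus, <- H2; ring).
rewrite !Hp, S_INR, RtoC_plus, Hp, <- H2.
field. split; assumption.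
Qed.

(** The factor [Gamma (m + 2)] is common to both sides; the other two each move up once. *)
Lemma Cbinom_shift_succ (m : C) (k : nat) :
  (forall j : nat, m + 1 <> - INR j) ->
  Cbinom (m + INR (S k) + 1) (INR (S k))
  = Cbinom (m + INR k + 1) (INR k) * ((m + INR k + 2) / (INR k + 1)).
Proof.
intros Hm.
assert (Hmk := nonpole_plus_INR (m + 1) Hm).
assert (Hk := RtoC_INR_plus_1_neq_0 k).
assert (HG : Gamma (INR k + 1) <> 0) by (apply Gamma_neq_0, RtoC_INR_neq_opp).
assert (HGm : Gamma (m + 2) <> 0).
{ replace (m + 2) with (m + 1 + INR 1) by (simpl; ring). apply Gamma_neq_0, Hmk. }
unfold Cbinom.
replace (m + INR (S k) + 1 - INR (S k) + 1) with (m + 2) by ring.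
replace (m + INR k + 1 - INR k + 1) with (m + 2) by ring.
replace (m + INR (S k) + 1 + 1) with (m + 1 + INR (S k) + 1) by ring.
replace (m + INR k + 1 + 1) with (m + 1 + INR (S k))
  by (rewrite S_INR, RtoC_plus; ring).
destruct (Gamma_succ _ (Hmk (S k))) as [-> _].
replace (RtoC (INR (S k))) with (RtoC (INR k) + 1) by (rewrite S_INR, RtoC_plus; ring).
destruct (Gamma_succ (INR k + 1)) as [-> _]; [intros j; apply RtoC_INR_neq_opp |].
field. repeat split; assumption.
Qed.

(** Lets [field] clear this denominator of the summand; each ratio [(m + k + 2) / (k + 1)] is
    nonzero. *)
Lemma Cbinom_shift_neq_0 (m : C) (k : nat) :
  (forall j : nat, m + 1 <> - INR j) -> Cbinom (m + INR k + 1) (INR k) <> 0.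
Proof.
intros Hm.
assert (Hmk := nonpole_plus_INR (m + 1) Hm).
induction k as [|k IH].
- simpl INR. rewrite Cbinom_0_r; [apply C1_nz |].
  intros j. replace (m + 0 + 1 + 1) with (m + 1 + INR 1) by (simpl; ring). apply Hmk.
- rewrite Cbinom_shift_succ by exact Hm.
  assert (Hk := RtoC_INR_plus_1_neq_0 k).
  apply Cmult_neq_0; [exact IH |].
  apply Cmult_neq_0; [| intros H; apply C1_nz; rewrite <- (Cinv_r _ Hk), H; ring].
  intros H. apply (Hmk (S k) 0%nat). rewrite S_INR, RtoC_plus.
  replace (m + 1 + (INR k + 1)) with (m + INR k + 2) by ring. rewrite H; simpl; ring.
Qed.

Lemma harmonic_succ (z : C) : (forall j : nat, z + 1 <> - INR j) ->
  harmonic (z + 1) = harmonic z + / (z + 1).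
Proof.
intros Hz. unfold harmonic. destruct (Gamma_succ _ Hz) as [_ ->]. ring.
Qed.

(** * Telescoping by induction on the number of terms *)

Theorem theorem4p1 (n : nat) (m : C) (hn : (1 <= n)%nat)
    (hm : forall j : Z, (j < 0)%Z -> m <> RtoC (IZR j))
    (hm32 : m <> - (3 / 2)) :
  sum_n_m
    (fun k : nat =>
       / 2 ^ (2 * k) / (2 * INR k - 1)
       * (Cbinom (2 * INR k) (INR k) / Cbinom (m + INR k + 1) (INR k))
       * harmonic (m + INR k + 1))
    1 n
  = (4 * m + 5) / ((m + 1) * (2 * m + 3) ^ 2)
    + harmonic m / (2 * m + 3)
    - / 2 ^ (2 * n) / (2 * m + 3)
      * (Cbinom (2 * INR n) (INR n) / Cbinom (m + INR n + 1) (INR n))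
      * (harmonic (m + INR n + 1) + 2 / (2 * m + 3)).
Proof.
(* Avoiding the negative integers is restated as [m + 1] avoiding the poles of [Gamma]. *)
assert (Hm : forall j : nat, m + 1 <> - INR j).
{ intros j H. apply (hm (- Z.of_nat (S j))%Z); [lia |].
  rewrite opp_IZR, <- INR_IZR_INZ, S_INR, RtoC_opp, RtoC_plus.
  replace m with (m + 1 - 1) by ring. rewrite H; ring. }
assert (Hmk := nonpole_plus_INR (m + 1) Hm).
assert (H32 : 2 * m + 3 <> 0).
{ intros H; apply hm32. replace m with ((2 * m + 3) / 2 - 3 / 2) by field.
  rewrite H; field. }
assert (Hm1 : m + 1 <> 0).
{ intros H; apply (Hm 0%nat). rewrite H; simpl; ring. }
(* The identity already holds at [n = 0], where the sum is empty. *)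
clear hn. induction n as [|n IH].
- rewrite sum_n_m_zero by lia.
  (* Expanding [harmonic (m + 1)] reduces the claim to [4 m + 5 = (2 m + 3) + 2 (m + 1)]. *)
  assert (Hh := harmonic_succ m Hm).
  simpl INR. replace (m + 0 + 1) with (m + 1) by ring. rewrite Cmult_0_r, Hh.
  rewrite !Cbinom_0_r.
  + change (@zero C_AbelianMonoid) with (RtoC 0). simpl. field. split; assumption.
  + intros j. replace (m + 1 + 1) with (m + 1 + INR 1) by (simpl; ring). apply Hmk.
  + intros j. replace (0 + 1) with (RtoC (INR 0) + 1) by (simpl; ring). apply RtoC_INR_neq_opp.
(* With [T n] the subtracted last term of the right-hand side, it remains to show that the new
   summand equals [T n - T (S n)]. All quantities at [S n] are reduced to those at [n]. *)
- rewrite sum_n_Sm by lia. rewrite IH. clear IH.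
  change plus with Cplus.
  rewrite Cbinom_double_succ, Cbinom_shift_succ by exact Hm.
  assert (HB := Cbinom_shift_neq_0 m n Hm).
  assert (Hh : harmonic (m + INR (S n) + 1) = harmonic (m + INR n + 1) + / (m + INR n + 2)).
  { replace (m + INR (S n) + 1) with (m + INR n + 1 + 1) by (rewrite S_INR, RtoC_plus; ring).
    rewrite harmonic_succ; [do 2 f_equal; ring |].
    intros j. replace (m + INR n + 1 + 1) with (m + 1 + INR (S n)) by (rewrite S_INR, RtoC_plus; ring).
    apply Hmk. }
  rewrite Hh.
  replace (/ 2 ^ (2 * S n)) with (/ 2 ^ (2 * n) / 4).
  2: { replace (2 * S n)%nat with (2 + 2 * n)%nat by lia. rewrite Cpow_add_r. simpl (2 ^ 2).
    field. apply Cpow_nz. intros H; apply RtoC_inj in H; lra. }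
  (* With these values made free variables, a rational identity remains. *)
  generalize (/ 2 ^ (2 * n)) (harmonic (m + INR n + 1)) (Cbinom (2 * INR n) (INR n)).
  intros P H A.
  rewrite S_INR, RtoC_plus.
  assert (Hn1 := RtoC_INR_plus_1_neq_0 n).
  assert (Hn2 : 2 * RtoC (INR n) + 1 <> 0).
  { intros E; apply (f_equal Re) in E; revert E; unfold Re; simpl. generalize (pos_INR n); lra. }
  assert (Hn3 : m + INR n + 2 <> 0).
  { intros E. apply (Hmk (S n) 0%nat). rewrite S_INR, RtoC_plus.
    replace (m + 1 + (INR n + 1)) with (m + INR n + 2) by ring. rewrite E; simpl; ring. }
  (* The denominator [2 k - 1] at [k = n + 1] becomes the factor [2 n + 1] supplied by the central
     binomial ratio. *)
  replace (2 * (INR n + 1) - 1) with (2 * RtoC (INR n) + 1) by ring.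
  match goal with |- ?a = ?b => change (@eq C a b) end.
  field. repeat split; assumption.
Qed.
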